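(* Let $a,k,d,e$ be integers with $1\le a\le k$, $1\le d\le k$, and either $e=d$ or $2e=d$. Let ${}_d\overline{B}_{dk+e,\,da}(n)$ be the number of partitions of $n$ such that $$\phi_i+\phi_{i+1}<dk+e\ \text{ for all } i\ge1,\qquad \phi_1<da,\qquad d\mid\phi_{2i+1}\ \text{ for all } i\ge 0.$$ Then $$\sum_{n\ge0}{}_d\overline{B}_{dk+e,\,da}(n)\,q^n=\frac{(q^{da},q^{2dk-da+2e+d},q^{2dk+2e+d};q^{2dk+2e+d})_\infty}{(q^{d};q^{2d})_\infty\,(q^2;q^2)_\infty}.$$
   Context: A partition of a nonnegative integer $n$ is a finite non-increasing sequence of positive integers summing to $n$ (the empty partition is the unique partition of $0$). For a partition and an integer $i\ge1$, $\phi_i$ denotes the number of times $i$ occurs as a part. For $|q|<1$: $(a;q)_n=(1-a)(1-aq)\cdots(1-aq^{n-1})$, $(a;q)_\infty=\lim_{n\to\infty}(a;q)_n$, and $(a_1,\dots,a_r;q)_\infty=(a_1;q)_\infty\cdots(a_r;q)_\infty$. The identity is of formal power series in $q$. *)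

(* Defs.v *)
From HB Require Import structures.
From mathcomp Require Import all_boot all_order all_algebra.
Set Implicit Arguments. Unset Strict Implicit. Unset Printing Implicit Defensive.
Import GRing.Theory.
Local Open Scope ring_scope.

Definition is_partition (n : nat) (s : seq nat) : Prop :=
  sorted geq s /\ all (fun x => 0 < x)%N s /\ sumn s = n.

Definition phi (s : seq nat) (i : nat) : nat := count_mem i s.

(* Truncation at degree N of (q^a; q^c)_infty, as a polynomial over int:
   the product of the factors (1 - q^(a + c j)) with a + c j <= N.
   (The omitted factors are congruent to 1 modulo q^(N+1); for c >= 1 every
   j with a + c j <= N satisfies j <= N.) *)
Definition qpoch_tr (N a c : nat) : {poly int} :=
  \prod_(0 <= j < N.+1 | (a + c * j <= N)%N) (1 - 'X^(a + c * j)).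

(* Truncation at degree N of 1 / (q^a; q^c)_infty: product over the factors
   with a + c j <= N of the geometric series 1/(1 - q^m), m = a + c j,
   each truncated to sum_{i <= N} q^(m i). *)
Definition qpoch_inv_tr (N a c : nat) : {poly int} :=
  \prod_(0 <= j < N.+1 | (a + c * j <= N)%N)
     \sum_(0 <= i < N.+1) 'X^((a + c * j) * i).

(* Main.v *)
Require Import Defs.
From HB Require Import structures.
From mathcomp Require Import all_boot all_order all_algebra.
From mathcomp Require Import qpoly ring zify.
Set Implicit Arguments. Unset Strict Implicit. Unset Printing Implicit Defensive.
Import GRing.Theory.
Local Open Scope ring_scope.

(** Put [K = dk + e], [M = 2K + d] and [[m]_y = 1 + y + ... + y^(m-1)].  Let [B_p(c)]
    be the generating function of the admissible partitions with all parts [>= p] and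
    [phi_p < c].  Removing the parts equal to [p] gives, with [y = q^p],
      [B_p(c + d) = B_p(c) + y^c B_(p+1)(K - c)]        (p odd, [d | c]),
      [B_p(c + d) = B_p(c) + y^c [d]_y B_(p+1)(K - c)]  (p even, [d | c - e]),
      [B_p(e) = [e]_y B_(p+1)(d(k + 1))]                (p even).
    On the other hand, the series
      [J_m(s) = Theta_m(M - s) - q^(s(m+1)) Theta_m(M + s)], where
      [Theta_m(t) = sum_n (-1)^n q^((Km+t)n + M n(n-1)/2) (q^(d(n+1));q^d)_m],
    which generalise those of Andrews, satisfy, whatever the parity of [m],
      [J_m(s + d) = J_m(s) + q^(s(m+1)) J_(m+1)(K - s)].
    Hence [B_p(c) (q^d;q^d)_oo = J_(p-1)(c) prod_(l >= p even) [d]_(q^l)]; the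
    hypothesis on [e] is what makes the initial condition at even [p] hold.  Finally
    [J_0] is a theta series, summed by Jacobi's triple product.

    Everything takes place in a commutative ring with a nilpotent element [q],
    eventually [int[X]/(X^(N+1))], where all sums and products are finite. *)

Lemma expr_nil_leq (R : pzSemiRingType) (x : R) m n :
  x ^+ m = 0 -> (m <= n)%N -> x ^+ n = 0.
Proof. by move=> xm0 /subnK <-; rewrite exprD xm0 mulr0. Qed.

Lemma exprMn_nil (R : comPzSemiRingType) (x y : R) n :
  x ^+ n = 0 -> (x * y) ^+ n = 0.
Proof. by move=> xn0; rewrite exprMn xn0 mul0r. Qed.

Lemma sum_ord_succ (V : zmodType) (g : nat -> V) n :
  g n = g 0 -> \sum_(i < n) g i.+1 = \sum_(i < n) g i.
Proof.
move=> gn; apply/eqP; rewrite -subr_eq0 -sumrB.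
by rewrite -(big_mkord xpredT (fun i => g i.+1 - g i)) telescope_sumr // gn subrr.
Qed.

(** * q-Pochhammer symbols *)

Section QPochhammer.
Variable R : comNzRingType.
Implicit Types a x z : R.

Definition qpoch a x n : R := \prod_(i < n) (1 - a * x ^+ i).

Lemma qpochSr a x n : qpoch a x n.+1 = qpoch a x n * (1 - a * x ^+ n).
Proof. exact: big_ord_recr. Qed.

Lemma qpochSl a x n : qpoch a x n.+1 = (1 - a) * qpoch (a * x) x n.
Proof.
rewrite /qpoch big_ord_recl expr0 mulr1; congr (_ * _).
by apply: eq_bigr => i _; rewrite exprS mulrA.
Qed.

Lemma qpoch_stable a x m n :
  a * x ^+ m = 0 -> (m <= n)%N -> qpoch a x n = qpoch a x m.
Proof.
move=> axm0 /subnKC <-; elim: (n - m)%N => [|j IHj]; first by rewrite addn0.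
by rewrite addnS qpochSr IHj exprD mulrA axm0 mul0r subr0 mulr1.
Qed.

Lemma qpoch_even_odd a x n :
  qpoch a x (2 * n) = qpoch a (x ^+ 2) n * qpoch (a * x) (x ^+ 2) n.
Proof.
elim: n => [|n IHn]; first by rewrite /qpoch !big_ord0 mulr1.
by rewrite mulnS !qpochSr IHn (exprS x (2 * n)) exprM; ring.
Qed.

Definition qnat x n : R := \sum_(i < n) x ^+ i.

Lemma qnatD x m n : qnat x (m + n) = qnat x m + x ^+ m * qnat x n.
Proof.
rewrite /qnat big_split_ord mulr_sumr; congr (_ + _).
by apply: eq_bigr => i _; rewrite exprD.
Qed.

Lemma mul_qnat x n : (1 - x) * qnat x n = 1 - x ^+ n.
Proof. by rewrite -opprB mulNr -subrX1 opprB. Qed.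

Lemma qpoch_lreg a x m n : a ^+ n = 0 -> GRing.lreg (qpoch a x m).
Proof.
move=> an0; apply: (big_ind (@GRing.lreg R)) => [|y z|i _].
- exact: lreg1.
- exact: lregM.
apply: (can_inj (g := *%R (qnat (a * x ^+ i) n))) => z.
by rewrite mulrA [qnat _ _ * _]mulrC mul_qnat exprMn an0 mul0r subr0 mul1r.
Qed.

Lemma prod_qnat x d n :
  (\prod_(i < n) qnat (x ^+ i.+1) d) * qpoch x x n = qpoch (x ^+ d) (x ^+ d) n.
Proof.
rewrite -big_split; apply: eq_bigr => i _ /=.
by rewrite -exprS mulrC mul_qnat exprAC exprS.
Qed.

End QPochhammer.

(** * Partial theta series *)

Section PartialTheta.
Variable R : comNzRingType.
Implicit Types w x y z : R.

Definition theta_term w z n : R := (-1) ^+ n * z ^+ n * w ^+ 'C(n, 2).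

Lemma theta_term0 w z : theta_term w z 0 = 1.
Proof. by rewrite /theta_term !mulr1. Qed.

Lemma theta_termM w y z n : theta_term w (y * z) n = y ^+ n * theta_term w z n.
Proof. by rewrite /theta_term exprMn; ring. Qed.

Lemma theta_termS w z n :
  theta_term w z n.+1 = - (z * w ^+ n) * theta_term w z n.
Proof. by rewrite /theta_term binS bin1 exprD !exprS; ring. Qed.

Lemma theta_term_nil w z m n : z ^+ m = 0 -> (m <= n)%N -> theta_term w z n = 0.
Proof. by move=> zm0 mn; rewrite /theta_term (expr_nil_leq zm0 mn) mulr0 mul0r. Qed.

Definition partial_theta b x y m z : R :=
  \sum_(n < b) theta_term (x ^+ 2 * y) (x ^+ m * z) n * qpoch (y ^+ n.+1) y m.

Lemma partial_thetaS b x y m z :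
  partial_theta b x y m.+1 z
  = partial_theta b x y m (x * z) - y ^+ m.+1 * partial_theta b x y m (x * y * z).
Proof.
rewrite mulr_sumr -sumrB; apply: eq_bigr => n _.
have -> : x ^+ m * (x * y * z) = y * (x ^+ m * (x * z)) by ring.
have -> : x ^+ m.+1 * z = x ^+ m * (x * z) by rewrite exprSr mulrA.
by rewrite qpochSr (theta_termM _ y) -exprD addSnnS exprD; ring.
Qed.

Lemma partial_theta_shift b x y m z : z ^+ b = 0 ->
  partial_theta b x y m (y * z)
  = partial_theta b x y m z + x ^+ m * z * partial_theta b x y m.+1 (x * y * z).
Proof.
move=> zb0; set w := x ^+ 2 * y.
pose g n := (1 - y ^+ n) * theta_term w (x ^+ m * z) n * qpoch (y ^+ n.+1) y m.
have gS n : g n.+1 = - (x ^+ m * z)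
    * (theta_term w (x ^+ m.+1 * (x * y * z)) n * qpoch (y ^+ n.+1) y m.+1).
  have -> : x ^+ m.+1 * (x * y * z) = w * (x ^+ m * z) by rewrite exprS /w; ring.
  by rewrite /g theta_termS (theta_termM _ w) qpochSl -exprSr; ring.
have: \sum_(n < b) g n.+1 = \sum_(n < b) g n.
  apply: sum_ord_succ; rewrite /g subrr !mul0r (theta_term_nil _ _ (leqnn b)).
    by rewrite mulr0 mul0r.
  by rewrite mulrC exprMn_nil.
under eq_bigr do rewrite gS; rewrite -mulr_sumr mulNr -/(partial_theta _ _ _ _ _).
have -> : \sum_(n < b) g n = partial_theta b x y m z - partial_theta b x y m (y * z).
  rewrite -sumrB; apply: eq_bigr => n _.
  by rewrite mulrCA (theta_termM _ y) /g -/w; ring.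
by move/esym/eqP; rewrite subr_eq => /eqP ->; ring.
Qed.

Lemma partial_theta_euler b y m z : (0 < b)%N -> y ^+ m = 0 -> z ^+ b = 0 ->
  partial_theta b 1 y m z = qpoch z y m * qpoch y y m.
Proof.
move=> b_gt0 ym0 zb0.
have peel z' : z' ^+ b = 0 ->
    partial_theta b 1 y m z' = (1 - z') * partial_theta b 1 y m (y * z').
  move=> zb0'; have := partial_theta_shift 1 y m zb0'.
  have -> : partial_theta b 1 y m.+1 (1 * y * z') = partial_theta b 1 y m (y * z').
    apply: eq_bigr => n _; rewrite !expr1n !mul1r (qpoch_stable _ (leqnSn m)) //.
    by rewrite -exprD addnC (expr_nil_leq ym0) ?leq_addr.
  by rewrite expr1n mul1r mulrBl mul1r => {1}->; rewrite addrK.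
have peel_n n : partial_theta b 1 y m z
    = qpoch z y n * partial_theta b 1 y m (y ^+ n * z).
  elim: n => [|n IHn]; first by rewrite /qpoch big_ord0 !mul1r.
  rewrite IHn peel; first by rewrite qpochSr exprS [z * _]mulrC -!mulrA.
  by rewrite mulrC exprMn_nil.
rewrite (peel_n m) ym0 mul0r; congr (_ * _).
case: b b_gt0 {zb0 peel peel_n} => // b _; rewrite /partial_theta big_ord_recl mulr0.
rewrite theta_term0 mul1r big1 ?addr0 // => n _.
by rewrite (theta_term_nil _ (expr1 0)) ?mul0r.
Qed.

End PartialTheta.

Section JacobiTripleProduct.
Variables (R : comNzRingType) (u v : R) (k : nat).
Hypotheses (u_nil : u ^+ k = 0) (v_nil : v ^+ k = 0).
Let w := u * v.

(* The term of index [l - n] of the bilateral series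
   [sum_(j in Z) (-1)^j u^j w^(j(j-1)/2)]. *)
Definition bilateral_term n l : R :=
  if (l < n)%N then theta_term w v (n - l) else theta_term w u (l - n).

Lemma bilateral_termS n l :
  - (v * w ^+ n) * bilateral_term n l = w ^+ l * bilateral_term n.+1 l.
Proof.
rewrite /bilateral_term ltnS; case: (ltngtP l n) => [ln|nl|->].
- by rewrite subSn 1?ltnW // theta_termS -[in w ^+ n](subnKC (ltnW ln)) exprD; ring.
- have -> : (l - n = (l - n.+1).+1)%N by lia.
  by rewrite theta_termS -[in w ^+ l](subnKC nl) exprD exprS /w; ring.
- by rewrite subnn subSnn theta_termS !theta_term0; ring.
Qed.

Let w_nil : w ^+ k = 0. Proof. exact: exprMn_nil. Qed.

(* For [b] large this is [(w;w)_oo (u;w)_oo (v;w)_n]: Euler's identity is the case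
   [n = 0], and for [n] large the [q]-Pochhammer factor of every nonzero term is 1. *)
Definition bilateral_sum b n : R :=
  \sum_(l < b) qpoch (w ^+ l.+1) w b * bilateral_term n l.

Lemma bilateral_sumS b n : (n + k < b)%N ->
  bilateral_sum b n.+1 = (1 - v * w ^+ n) * bilateral_sum b n.
Proof.
move=> nkb.
pose g l := (1 - w ^+ l) * qpoch (w ^+ l.+1) w b * bilateral_term n.+1 l.
have gS l : g l.+1 = qpoch (w ^+ l.+1) w b * bilateral_term n l.
  rewrite /g /bilateral_term ltnS subSS (exprSr w l.+1) -qpochSl.
  rewrite (qpoch_stable _ (leqnSn b)) //.
  by rewrite -exprD (expr_nil_leq w_nil) //; lia.
have shift : bilateral_sum b n = \sum_(l < b) g l.
  rewrite -sum_ord_succ; first by apply: eq_bigr => l _; rewrite gS.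
  rewrite /g subrr !mul0r /bilateral_term ltnNge.
  have -> : (n < b)%N by lia.
  by rewrite (theta_term_nil _ u_nil) ?mulr0 //; lia.
rewrite mulrBl mul1r {1}shift mulr_sumr -sumrB; apply: eq_bigr => l _.
have termS := bilateral_termS n l.
by rewrite /g; ring: termS.
Qed.

Lemma qpoch_bilateral_sum b n : (n + k < b)%N ->
  qpoch v w n * (qpoch u w b * qpoch w w b) = bilateral_sum b n.
Proof.
elim: n => [|n IHn] nkb; last first.
  by rewrite bilateral_sumS 1?ltnW // -IHn 1?ltnW // qpochSr; ring.
have kb : (k <= b)%N by apply: ltnW.
rewrite {1}/qpoch big_ord0 mul1r -(@partial_theta_euler _ b) ?(expr_nil_leq _ kb) //.
  by apply: eq_bigr => l _; rewrite !expr1n !mul1r mulrC /bilateral_term subn0.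
exact: leq_ltn_trans nkb.
Qed.

Lemma jacobi_triple_product n : (2 * k < n)%N ->
  qpoch u w n * qpoch v w n * qpoch w w n
  = \sum_(j < n) theta_term w u j + \sum_(j < n) theta_term w v j.+1.
Proof.
move=> kn; have wn0 : w ^+ n = 0 by apply: (expr_nil_leq w_nil); lia.
transitivity (qpoch v w n * (qpoch u w (n + n) * qpoch w w (n + n))).
  by rewrite !(qpoch_stable _ (leq_addr n n)) ?wn0 ?mulr0 //; ring.
rewrite qpoch_bilateral_sum; last by lia.
transitivity (\sum_(l < n + n) bilateral_term n l).
  apply: eq_bigr => l _; have [kl|lk] := leqP k l.+1.
    rewrite (@qpoch_stable _ _ _ 0) ?(expr_nil_leq w_nil kl) ?mul0r //.
    by rewrite /qpoch big_ord0 mul1r.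
  rewrite /bilateral_term; have -> : (l < n)%N by lia.
  by rewrite (theta_term_nil _ v_nil) ?mulr0 //; lia.
rewrite big_split_ord [RHS]addrC /=; congr (_ + _); last first.
  by apply: eq_bigr => j _; rewrite /bilateral_term ltnNge leq_addr addKn.
rewrite (reindex_inj rev_ord_inj); apply: eq_bigr => j _ /=.
have jn := ltn_ord j; rewrite /bilateral_term.
have -> : (n - j.+1 < n)%N by lia.
by congr theta_term; lia.
Qed.

End JacobiTripleProduct.

(** * Andrews' series *)

Section AndrewsSeries.
Variables (R : comNzRingType) (q : R) (n d K : nat).
Hypothesis q_nil : q ^+ n = 0.
Hypothesis K_gt0 : (0 < K)%N.
Let M := (2 * K + d)%N.
Let theta m t := partial_theta n (q ^+ K) (q ^+ d) m (q ^+ t).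

Definition andrews_series m s : R :=
  theta m (M - s) - q ^+ (s * m.+1) * theta m (M + s).

Let thetaS m t :
  theta m.+1 t = theta m (K + t) - q ^+ (d * m.+1) * theta m (K + d + t).
Proof. by rewrite /theta partial_thetaS !exprD !exprM. Qed.

Let theta_shift m t : (0 < t)%N ->
  theta m (d + t) = theta m t + q ^+ (K * m + t) * theta m.+1 (K + d + t).
Proof.
move=> t_gt0; rewrite /theta !exprD exprM partial_theta_shift //.
by rewrite -exprM mulnC exprM q_nil expr0n eqn0Ngt t_gt0.
Qed.

Lemma andrews_series0 m : andrews_series m 0 = 0.
Proof. by rewrite /andrews_series subn0 addn0 mul1r subrr. Qed.

Lemma andrews_seriesDd m s r : (s + r)%N = K ->
  andrews_series m (s + d)
  = andrews_series m s + q ^+ (s * m.+1) * andrews_series m.+1 r.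
Proof.
move=> srK; rewrite /andrews_series.
have -> : (M - (s + d) = K + r)%N by lia.
have -> : (M - s = d + (K + r))%N by lia.
have -> : (M + (s + d) = K + d + (K + s + d))%N by lia.
have -> : (M + s = K + (K + s + d))%N by lia.
have -> : (M - r = K + s + d)%N by lia.
have -> : (M + r = K + d + (K + r))%N by lia.
rewrite theta_shift ?addn_gt0 ?K_gt0 // (thetaS m (K + s + d)).
have -> : q ^+ ((s + d) * m.+1) = q ^+ (s * m.+1) * q ^+ (d * m.+1).
  by rewrite -exprD -mulnDl.
have -> : q ^+ (K * m + (K + r)) = q ^+ (s * m.+1) * q ^+ (r * m.+2).
  by rewrite -exprD; congr (_ ^+ _); rewrite -srK; ring.
by ring.
Qed.

(* The recurrence [andrews_seriesDd] at the negative argument [- s], multiplied by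
   [- q ^+ (s * m.+1)]: formally [andrews_series m] changes sign and gets divided by
   [q ^+ (s * m.+1)] when [s] is replaced with [- s]. *)
Lemma andrews_series_reflect m s r : (s + r)%N = d ->
  andrews_series m s + q ^+ (s * m.+1) * andrews_series m r
  = andrews_series m.+1 (K + s).
Proof.
move=> srd; rewrite /andrews_series.
have -> : (M - s = K + (K + r))%N by lia.
have -> : (M + s = d + (2 * K + s))%N by lia.
have -> : (M - r = 2 * K + s)%N by lia.
have -> : (M + r = K + d + (K + r))%N by lia.
have -> : (M - (K + s) = K + r)%N by lia.
have -> : (M + (K + s) = K + d + (2 * K + s))%N by lia.
rewrite theta_shift ?addn_gt0 ?muln_gt0 ?K_gt0 // (thetaS m (K + r)).
have -> : q ^+ (d * m.+1) = q ^+ (s * m.+1) * q ^+ (r * m.+1).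
  by rewrite -exprD -mulnDl srd.
have -> : q ^+ ((K + s) * m.+2) = q ^+ (s * m.+1) * q ^+ (K * m + (2 * K + s)).
  by rewrite -exprD; congr (_ ^+ _); ring.
by ring.
Qed.

Lemma andrews_series_large m s : (n <= m)%N -> (0 < s)%N ->
  andrews_series m s = qpoch (q ^+ d) (q ^+ d) m.
Proof.
move=> nm s_gt0; rewrite /andrews_series.
have -> : q ^+ (s * m.+1) = 0 by apply: (expr_nil_leq q_nil); nia.
have qKm0 : (q ^+ K) ^+ m = 0 by rewrite -exprM; apply: (expr_nil_leq q_nil); nia.
have n_gt0 : (0 < n)%N.
  by case: n q_nil => // /eqP; rewrite expr0 oner_eq0.
rewrite mul0r subr0 /theta /partial_theta qKm0 mul0r.
rewrite -(prednK n_gt0) big_ord_recl theta_term0 mul1r big1 ?addr0 // => j _.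
by rewrite (theta_term_nil _ (expr1 0)) ?mul0r.
Qed.

Lemma andrews_series_product s k : (0 < s < M)%N -> q ^+ k = 0 -> (2 * k < n)%N ->
  andrews_series 0 s
  = qpoch (q ^+ s) (q ^+ M) n * qpoch (q ^+ (M - s)) (q ^+ M) n
    * qpoch (q ^+ M) (q ^+ M) n.
Proof.
move=> /andP[s_gt0 sM] qk0 kn.
have qX_nil t : (0 < t)%N -> (q ^+ t) ^+ k = 0.
  by move=> t_gt0; rewrite -exprM; apply: (expr_nil_leq qk0); rewrite leq_pmull.
have Ms_gt0 : (0 < M - s)%N by rewrite subn_gt0.
have -> : q ^+ M = q ^+ (M - s) * q ^+ s by rewrite -exprD subnK // ltnW.
rewrite [qpoch (q ^+ s) _ n * _]mulrC (@jacobi_triple_product _ _ _ k) ?qX_nil //.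
rewrite /andrews_series /theta /partial_theta -exprD subnK; last exact: ltnW.
have -> : (q ^+ K) ^+ 2 * q ^+ d = q ^+ M by rewrite -exprM -exprD mulnC.
congr (_ + _); first by apply: eq_bigr => j _; rewrite /qpoch big_ord0 mulr1 mul1r.
rewrite muln1 -mulNr mulr_sumr; apply: eq_bigr => j _.
by rewrite /qpoch big_ord0 mulr1 mul1r theta_termS exprD theta_termM; ring.
Qed.

End AndrewsSeries.

(** * Enumeration of the partitions *)

Section Admissible.
Local Open Scope nat_scope.
Variables d K : nat.

Definition admissible m p c (s : seq nat) : Prop :=
  [/\ sorted geq s, all (fun x => p <= x < p + m) s, phi s p < c,
      forall i, p <= i -> phi s i + phi s i.+1 < K &
      forall i, odd i -> d %| phi s i].

Definition restricted_partition n c (s : seq nat) : Prop :=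
  [/\ is_partition n s, forall i, 1 <= i -> phi s i + phi s i.+1 < K,
      phi s 1 < c & forall i, d %| phi s (2 * i).+1].

Fixpoint admissibles m p c : seq (seq nat) :=
  if m is m'.+1 then
    [seq s ++ nseq t p | t <- [seq t <- iota 0 c | odd p ==> (d %| t)],
                         s <- admissibles m' p.+1 (K - t)]
  else [:: [::]].

Lemma phi_cat_nseq s t p i : phi (s ++ nseq t p) i = phi s i + (p == i) * t.
Proof. by rewrite /phi count_cat count_nseq. Qed.

Lemma phi_min s p : all (leq p.+1) s -> phi s p = 0.
Proof. by move=> /allP ps; apply/count_memPn/negP => /ps; rewrite ltnn. Qed.

Lemma geq_trans : transitive geq.
Proof. by move=> y x z yx zy; apply: leq_trans zy yx. Qed.

Lemma sorted_geq_cat_nseq s t p :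
  all (leq p) s -> sorted geq (s ++ nseq t p) = sorted geq s.
Proof.
move=> ps; rewrite !(sorted_pairwise geq_trans) pairwise_cat.
have -> : pairwise geq (nseq t p).
  by elim: t => //= t ->; rewrite all_nseq /= leqnn orbT.
rewrite andbT; apply: andb_idl => _; apply/allrelP => x y xs.
by rewrite mem_nseq => /andP[_ /eqP ->]; apply: (allP ps).
Qed.

Lemma sorted_geq_split_min s p : sorted geq s -> all (leq p) s ->
  s = [seq x <- s | p < x] ++ nseq (phi s p) p.
Proof.
elim: s => //= x s IHs; rewrite (path_sortedE geq_trans).
move=> /andP[sx ss] /andP[px ps]; rewrite /phi /= -/(phi s p).
case: ltngtP px => // [px _|xp _]; first by rewrite add0n cat_cons -IHs.
have no_larger : [seq y <- s | p < y] = [::].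
  rewrite -(filter_pred0 s); apply: eq_in_filter => y /(allP sx) /=.
  by rewrite -xp leqNgt => /negPf.
by rewrite {1}(IHs ss ps) no_larger xp.
Qed.

Lemma admissible_cat_nseq m p c s t : all (leq p.+1) s ->
  admissible m.+1 p c (s ++ nseq t p)
  <-> [/\ t < c, odd p ==> (d %| t) & admissible m p.+1 (K - t) s].
Proof.
move=> ps; have le_ps : all (leq p) s by apply: sub_all ps => x; apply: ltnW.
have phi_p : phi (s ++ nseq t p) p = t by rewrite phi_cat_nseq phi_min // eqxx mul1n.
have phi_gt i : p < i -> phi (s ++ nseq t p) i = phi s i.
  by move=> pi; rewrite phi_cat_nseq ltn_eqF // addn0.
split=> [[s_sorted s_parts + phi_K phi_d]|].
  rewrite phi_p => tc; split=> //; first by apply/implyP => /phi_d; rewrite phi_p.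
  split; first by rewrite -(sorted_geq_cat_nseq t le_ps).
  - move: s_parts; rewrite all_cat => /andP[s_parts _].
    apply/allP => x xs; rewrite (allP ps) // addSnnS.
    by case/andP: (allP s_parts x xs).
  - by rewrite ltn_subRL -{1}phi_p -phi_gt // phi_K.
  - by move=> i pi; rewrite -!phi_gt ?phi_K ?(ltnW pi) // ltnW.
  - move=> i /phi_d; rewrite phi_cat_nseq; case: eqP => [<-|_]; last by rewrite addn0.
    by rewrite phi_min.
case=> tc t_d [s_sorted s_parts phi_c phi_K phi_d]; split.
- by rewrite sorted_geq_cat_nseq.
- rewrite all_cat all_nseq leqnn addnS ltnS leq_addr orbT andbT.
  apply/allP => x xs; have := allP s_parts x xs.
  by rewrite addSn => /andP[/ltnW -> ->].
- by rewrite phi_p.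
- move=> i; rewrite leq_eqVlt => /predU1P[<-|pi].
    by rewrite phi_p phi_gt // -ltn_subRL.
  by rewrite !phi_gt ?phi_K // ltnW.
- move=> i i_odd; rewrite phi_cat_nseq.
  case: eqP => [pi|_]; last by rewrite addn0 phi_d.
  by rewrite -pi phi_min // mul1n; rewrite -pi in i_odd; apply: implyP t_d i_odd.
Qed.

Lemma mem_admissibles m p c s : 0 < c <= K ->
  s \in admissibles m p c <-> admissible m p c s.
Proof.
elim: m p c s => [|m IHm] p c s /andP[c_gt0 cK] /=.
  rewrite inE; split=> [/eqP ->|[_ + _ _ _]].
    by split=> // i _; apply: leq_trans cK.
  by case: s => //= x s; rewrite addn0 ltnNge andbN.
have cK_t t : t < c -> 0 < K - t <= K.
  by move=> tc; rewrite subn_gt0 leq_subr (leq_trans tc).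
split=> [/allpairsPdep[t [w [t_in w_in ->]]]|s_adm].
  move: t_in; rewrite mem_filter mem_iota add0n /= => /andP[t_d tc].
  have w_adm := (IHm _ _ _ (cK_t t tc)).1 w_in.
  apply/admissible_cat_nseq; last by split.
  by case: w_adm => _ + _ _ _; apply: sub_all => x /andP[].
have [s_sorted s_parts _ _ _] := s_adm.
have s_split : s = [seq x <- s | p < x] ++ nseq (phi s p) p.
  by apply: sorted_geq_split_min s_sorted _; apply: sub_all s_parts => x /andP[].
have {s_adm} : admissible m.+1 p c ([seq x <- s | p < x] ++ nseq (phi s p) p).
  by rewrite -s_split.
case/(admissible_cat_nseq _ _ _ (filter_all _ _)) => tc t_d w_adm.
apply/allpairsPdep; exists (phi s p), [seq x <- s | p < x]; split=> //.
  by rewrite mem_filter t_d mem_iota.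
by apply/IHm; first exact: cK_t.
Qed.

Lemma admissibles_ge m p c s : s \in admissibles m p c -> all (leq p) s.
Proof.
elim: m p c s => [|m IHm] p c s /=; first by rewrite inE => /eqP ->.
case/allpairsPdep=> t [w [_ /IHm pw ->]]; rewrite all_cat all_nseq leqnn orbT andbT.
by apply: sub_all pw => x; apply: ltnW.
Qed.

Lemma admissibles_uniq m p c : uniq (admissibles m p c).
Proof.
elim: m p c => [|m IHm] p c //=.
apply: allpairs_uniq_dep => [|t _|]; [by rewrite filter_uniq ?iota_uniq|exact: IHm|].
move=> _ _ /allpairsPdep[t [w [_ w_in ->]]] /allpairsPdep[t' [w' [_ w_in' ->]]] /=.
move=> eq_s; have eq_t : t = t'.
  have /= := congr1 (phi ^~ p) eq_s; rewrite !phi_cat_nseq eqxx !mul1n.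
  by rewrite !phi_min //; apply: admissibles_ge; eassumption.
move: eq_s; rewrite -eq_t => eq_s.
have eq_size : size w = size w'.
  by have := congr1 size eq_s; rewrite !size_cat => /addIn.
by move/eqP: eq_s; rewrite eqseq_cat // eqxx andbT => /eqP ->.
Qed.

Lemma restricted_partition_admissible n m c s : n <= m ->
  restricted_partition n c s <-> admissible m 1 c s /\ sumn s = n.
Proof.
move=> nm; split=> [[[s_sorted [s_pos s_sum]] phi_K phi_1 phi_d]|].
  split=> //; split=> // [|i i_odd]; last first.
    by rewrite -(odd_double_half i) i_odd add1n -mul2n.
  apply/allP => x xs; rewrite (allP s_pos) //= add1n ltnS (leq_trans _ nm) // -s_sum.
  by rewrite sumnE (big_rem x xs) leq_addr.
case=> [[s_sorted s_parts phi_1 phi_K phi_d] s_sum]; split=> // [|i].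
  by split=> //; split=> //; apply: sub_all s_parts => x /andP[].
by apply: phi_d; rewrite /= mul2n odd_double.
Qed.

Lemma size_restricted_partitions n m c (L : seq (seq nat)) :
    n <= m -> 0 < c <= K -> uniq L ->
    (forall s, s \in L <-> restricted_partition n c s) ->
  size L = count (fun s => sumn s == n) (admissibles m 1 c).
Proof.
move=> nm cK uniq_L mem_L; have restrictedE := restricted_partition_admissible.
rewrite -size_filter; apply/perm_size/uniq_perm => // [|s].
  by rewrite filter_uniq ?admissibles_uniq.
rewrite mem_filter; apply/idP/andP => [|[/eqP s_sum s_in]].
  move=> /mem_L/(restrictedE _ _ _ _ nm)[s_adm ->].
  by split=> //; apply/mem_admissibles.
apply/mem_L/(restrictedE _ _ _ _ nm).
by split=> //; apply/mem_admissibles.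
Qed.

End Admissible.

(** * Generating functions of the partitions *)

Section GeneratingFunction.
Variables (R : comNzRingType) (q : R) (d K : nat).

Definition admissible_gf m p c : R := \sum_(s <- admissibles d K m p c) q ^+ sumn s.

Lemma admissible_gfS m p c :
  admissible_gf m.+1 p c
  = \sum_(0 <= t < c | odd p ==> (d %| t)%N)
      q ^+ (p * t) * admissible_gf m p.+1 (K - t).
Proof.
rewrite /admissible_gf big_allpairs_dep big_filter /index_iota subn0.
apply: eq_bigr => t _; rewrite mulr_sumr; apply: eq_bigr => s _.
by rewrite sumn_cat sumn_nseq addnC exprD.
Qed.

Lemma admissible_gf0r m p : admissible_gf m.+1 p 0 = 0.
Proof. by rewrite admissible_gfS big_geq. Qed.

Lemma admissible_gf_odd_ceil m p c a : odd p -> (d * a < c <= d * a.+1)%N ->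
  admissible_gf m p c = admissible_gf m p (d * a.+1).
Proof.
case: m => // m p_odd /andP[da_c c_da]; rewrite !admissible_gfS p_odd.
rewrite [RHS](big_cat_nat (n := c)) //= [X in _ + X]big_nat_cond.
rewrite [X in _ + X]big1 ?addr0 // => t /andP[/andP[ct t_da] /dvdnP[j t_jd]].
by have [ja|ja] := leqP j a; nia.
Qed.

Lemma admissible_gf_oddS m p a : (0 < d)%N -> odd p ->
  admissible_gf m.+1 p (d * a.+1)
  = admissible_gf m.+1 p (d * a)
    + q ^+ (p * (d * a)) * admissible_gf m p.+1 (K - d * a).
Proof.
move=> d_gt0 p_odd.
have ceil : (d * a < (d * a).+1 <= d * a.+1)%N.
  by rewrite ltnSn ltn_mul2l d_gt0 ltnSn.
rewrite -(admissible_gf_odd_ceil _ p_odd ceil).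
by rewrite !admissible_gfS p_odd big_mkcond big_nat_recr // -big_mkcond /= dvdn_mulr.
Qed.

(* For [c <= t < c + l], the multiplicity of the odd part [p + 1] is a multiple of [d]
   below [K - t], hence below [d * a.+1]. *)
Lemma admissible_gf_evenD m p c l a : ~~ odd p ->
  (forall t, (c <= t < c + l)%N -> (d * a < K - t <= d * a.+1)%N) ->
  admissible_gf m.+1 p (c + l)
  = admissible_gf m.+1 p c
    + q ^+ (p * c) * qnat (q ^+ p) l * admissible_gf m p.+1 (d * a.+1).
Proof.
move=> p_even ceil; rewrite !admissible_gfS (negPf p_even).
rewrite (big_cat_nat (n := c)) ?leq_addr //=; congr (_ + _).
rewrite -{1}[c]add0n big_addn addKn big_mkord -mulrA mulrCA /qnat [RHS]mulr_suml.
apply: eq_bigr => t _; have tl := ltn_ord t.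
rewrite mulnDr exprD exprM -mulrA; congr (_ * (_ * _)).
by apply: admissible_gf_odd_ceil => //; apply: ceil; lia.
Qed.

End GeneratingFunction.

Lemma rmorph_admissible_gf (R S : comNzRingType) (f : {rmorphism R -> S}) (q : R)
    d K m p c :
  f (admissible_gf q d K m p c) = admissible_gf (f q) d K m p c.
Proof. by rewrite rmorph_sum; apply: eq_bigr => s _; rewrite rmorphXn. Qed.

Lemma coef_admissible_gf (R : comNzRingType) d K m p c n :
  (admissible_gf ('X : {poly R}) d K m p c)`_n
  = (count (fun s => sumn s == n) (admissibles d K m p c))%:R.
Proof.
rewrite coef_sum -sum1_count natr_sum [RHS]big_mkcond; apply: eq_bigr => s _.
by rewrite coefXn eq_sym; case: eqP.
Qed.

Section Solution.
Variables (R : comNzRingType) (q : R) (n d e k : nat).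
Hypothesis q_nil : q ^+ n = 0.
Hypotheses (d_gt0 : (0 < d)%N) (e_d : e = d \/ (2 * e)%N = d).
Let K := (d * k + e)%N.
Let gf := admissible_gf q d K.
Let J := andrews_series q n d K.

Let e_gt0 : (0 < e)%N. Proof. by case: e_d; lia. Qed.
Let K_gt0 : (0 < K)%N. Proof. by rewrite addn_gt0 e_gt0 orbT. Qed.

(* Reflecting [d - e]: the series at [d - e] is [0] if [e = d], and the one at [e] if
   [2 * e = d]. *)
Lemma andrews_series_initial m :
  J m e * qnat (q ^+ m.+1) d = qnat (q ^+ m.+1) e * J m.+1 (d * k.+1).
Proof.
have le_ed : (e <= d)%N by case: e_d; lia.
have -> : (d * k.+1 = K + (d - e))%N by rewrite mulnS /K; lia.
rewrite /J -(andrews_series_reflect q_nil K_gt0 m (subnK le_ed)).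
case: e_d => [<-|<-]; first by rewrite subnn andrews_series0 mul1r add0r mulrC.
have -> : (2 * e - e = e)%N by lia.
by rewrite mul2n -addnn qnatD -exprM mulnC; ring.
Qed.

Lemma admissible_gf_andrews_odd m p (C W : R) : ~~ odd p ->
  (forall b, (b <= k)%N -> gf m p.+2 (d * b + e) * C = J p.+1 (d * b + e) * W) ->
  forall a, (a <= k.+1)%N -> gf m.+1 p.+1 (d * a) * C = J p (d * a) * W.
Proof.
move=> p_even even_sol; elim=> [_|a IHa a_k].
  by rewrite muln0 /gf admissible_gf0r /J andrews_series0 !mul0r.
have da_K : (d * a + (d * (k - a) + e) = K)%N by rewrite /K mulnBr; nia.
have K_sub_da : (K - d * a = d * (k - a) + e)%N by rewrite -da_K addKn.
rewrite /gf admissible_gf_oddS // K_sub_da mulrDl IHa 1?ltnW // -mulrA.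
rewrite even_sol ?leq_subr // mulnSr /J (andrews_seriesDd _ q_nil K_gt0 _ da_K).
by rewrite [(d * a * _)%N]mulnC; ring.
Qed.

Lemma admissible_gf_andrews_even m p (C W : R) : odd p ->
  (forall a, (0 < a <= k.+1)%N -> gf m p.+2 (d * a) * C = J p.+1 (d * a) * W) ->
  forall b, (b <= k)%N ->
  gf m.+1 p.+1 (d * b + e) * C = J p (d * b + e) * (qnat (q ^+ p.+1) d * W).
Proof.
move=> p_odd odd_sol; elim=> [_|b IHb b_k].
  have ceil t : (0 <= t < 0 + e)%N -> (d * k < K - t <= d * k.+1)%N.
    by rewrite mulnS /K; lia.
  rewrite muln0 /gf (admissible_gf_evenD _ _ _ ceil) ?negbK //.
  rewrite admissible_gf0r muln0 add0r mul1r -mulrA odd_sol ?leqnn //.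
  by rewrite [RHS]mulrA andrews_series_initial mulrA.
have [r k_br] : exists r, k = (b + r.+1)%N by exists (k - b.+1)%N; lia.
rewrite mulnSr -addnA [(d + e)%N]addnC addnA /gf.
have ceil t : (d * b + e <= t < d * b + e + d)%N -> (d * r < K - t <= d * r.+1)%N.
  by rewrite mulnS /K k_br; nia.
rewrite (admissible_gf_evenD _ _ _ ceil) ?negbK //.
rewrite mulrDl IHb 1?ltnW // -mulrA odd_sol ?k_br; last by lia.
have db_K : (d * b + e + d * r.+1 = K)%N by rewrite /K k_br; nia.
rewrite /J (andrews_seriesDd _ q_nil K_gt0 _ db_K).
by rewrite [((d * b + e) * _)%N]mulnC; ring.
Qed.

Lemma admissible_gf_andrews i j a : (n <= 2 * (i + j))%N -> (0 < a <= k.+1)%N ->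
  gf (2 * j) (2 * i).+1 (d * a) * qpoch (q ^+ d) (q ^+ d) (2 * (i + j))
  = J (2 * i) (d * a) * \prod_(i <= l < i + j) qnat ((q ^+ 2) ^+ l.+1) d.
Proof.
elim: j i a => [|j IHj] i a ij /andP[a_gt0 a_k].
  rewrite addn0 big_geq // mulr1 /J andrews_series_large ?muln_gt0 ?d_gt0 //.
    by rewrite /gf /admissible_gf big_seq1 mul1r.
  by rewrite addn0 in ij.
have -> : (2 * j.+1 = (2 * j).+2)%N by lia.
rewrite big_ltn -?exprM; last by lia.
have i_even : ~~ odd (2 * i) by rewrite mul2n odd_double.
apply: (admissible_gf_andrews_odd i_even) a_k => b b_k.
have -> : (2 * i.+1 = (2 * i).+2)%N by lia.
apply: (admissible_gf_andrews_even (p := (2 * i).+1)) b_k => // a' a'_k.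
have -> : ((2 * i).+2 = 2 * i.+1)%N by lia.
by rewrite addnS -addSn IHj // addSn -addnS.
Qed.

Lemma admissible_gf_mul_qpoch j a : (n <= 2 * j)%N -> (0 < a <= k.+1)%N ->
  gf (2 * j) 1 (d * a) * (qpoch (q ^+ d) (q ^+ (2 * d)) j * qpoch (q ^+ 2) (q ^+ 2) j)
  = J 0 (d * a).
Proof.
move=> nj a_k; have qd_nil : (q ^+ (2 * d)) ^+ n = 0.
  by rewrite -exprM; apply: (expr_nil_leq q_nil); rewrite leq_pmull // muln_gt0.
apply: (@qpoch_lreg _ _ (q ^+ (2 * d)) j _ qd_nil).
have := admissible_gf_andrews (i := 0) (j := j) nj a_k.
rewrite big_mkord muln0 add0n qpoch_even_odd.
rewrite -exprD -exprM addnn -mul2n [(d * 2)%N]mulnC => sol.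
by rewrite [in RHS]exprM -(prod_qnat (q ^+ 2)) [RHS]mulrC [RHS]mulrA -sol; ring.
Qed.

End Solution.

(** * Truncation *)

Section Truncation.
Variables (R : comNzRingType) (f : {rmorphism {poly int} -> R}) (N : nat).
Let q := f 'X.
Hypothesis q_nil : q ^+ N.+1 = 0.

Let qpoch_tr_stable a c n : (0 < c)%N -> (N < n)%N ->
  qpoch (q ^+ a) (q ^+ c) n = qpoch (q ^+ a) (q ^+ c) N.+1.
Proof.
move=> c_gt0; apply: qpoch_stable.
by rewrite -exprM mulnC exprM q_nil expr0n eqn0Ngt c_gt0 mulr0.
Qed.

Lemma rmorph_qpoch_tr a c n : (0 < c)%N -> (N < n)%N ->
  f (qpoch_tr N a c) = qpoch (q ^+ a) (q ^+ c) n.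
Proof.
move=> c_gt0 Nn; rewrite qpoch_tr_stable //.
rewrite rmorph_prod big_mkcond big_mkord; apply: eq_bigr => j _ /=.
rewrite -exprM -exprD; case: leqP => [_|Naj].
  by rewrite rmorphB rmorph1 rmorphXn.
by rewrite (expr_nil_leq q_nil Naj) subr0.
Qed.

Lemma mul_qpoch_inv_tr a c n : (0 < a)%N -> (0 < c)%N -> (N < n)%N ->
  qpoch (q ^+ a) (q ^+ c) n * f (qpoch_inv_tr N a c) = 1.
Proof.
move=> a_gt0 c_gt0 Nn; rewrite qpoch_tr_stable //.
rewrite rmorph_prod big_mkcond big_mkord -big_split big1 // => j _ /=.
rewrite -exprM -exprD; case: leqP => [_|Naj]; last first.
  by rewrite (expr_nil_leq q_nil Naj) subr0 mulr1.
rewrite big_mkord rmorph_sum /=.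
under eq_bigr do rewrite rmorphXn exprM.
rewrite mul_qnat -exprM (expr_nil_leq q_nil) ?subr0 //; nia.
Qed.

Variables d e k a : nat.
Hypotheses (d_gt0 : (0 < d)%N) (e_d : e = d \/ (2 * e)%N = d).
Hypotheses (a_gt0 : (0 < a)%N) (a_k : (a <= k)%N).
Let K := (d * k + e)%N.
Let M := (2 * K + d)%N.

Lemma admissible_gf_product :
  admissible_gf q d K (2 * N.+2) 1 (d * a)
  = f (qpoch_tr N (d * a) M) * f (qpoch_tr N (M - d * a) M) * f (qpoch_tr N M M)
    * f (qpoch_inv_tr N d (2 * d)) * f (qpoch_inv_tr N 2 2).
Proof.
set n := N.+2; have Nn : (N < n)%N by [].
have a_k1 : (0 < a <= k.+1)%N by rewrite a_gt0 leqW.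
have da_M : (0 < d * a < M)%N by rewrite muln_gt0 d_gt0 /M /K; nia.
have q_nil2 : q ^+ (2 * n) = 0 by apply: (expr_nil_leq q_nil); lia.
rewrite !(@rmorph_qpoch_tr _ _ (2 * n)) //; try lia.
rewrite -(andrews_series_product da_M q_nil) //; last by lia.
rewrite -(admissible_gf_mul_qpoch q_nil2 d_gt0 e_d (leqnn _) a_k1) -/K.
have d2_gt0 : (0 < 2 * d)%N by rewrite muln_gt0.
have inv_d := mul_qpoch_inv_tr d_gt0 d2_gt0 Nn.
have inv_2 := mul_qpoch_inv_tr (isT : 0 < 2)%N (isT : 0 < 2)%N Nn.
by ring: inv_d inv_2.
Qed.

End Truncation.

Section QuotientByXn.
Variables (R : comNzRingType) (n : nat).

Lemma coef_in_qpolyXn (p : {poly R}) i : (i <= n)%N ->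
  (in_qpoly 'X^(n.+1) p)`_i = p`_i.
Proof.
move=> i_n; rewrite /in_qpoly /= mk_monic_Xn /=.
rewrite {2}(Pdiv.RingMonic.rdivp_eq (monicXn _ n.+1) p).
by rewrite coefD coefMXn ltnS i_n add0r.
Qed.

Lemma in_qpolyX_nil : in_qpoly ('X^(n.+1) : {poly R}) 'X ^+ n.+1 = 0.
Proof.
rewrite -rmorphXn /=; apply: val_inj => /=.
by rewrite mk_monic_Xn /= (Pdiv.RingMonic.rmodpp (monicXn _ n.+1)).
Qed.

End QuotientByXn.

Theorem theorem3p1 (a k d e : nat)
  (ha : (1 <= a <= k)%N) (hd : (1 <= d <= k)%N) (he : e = d \/ (2 * e)%N = d)
  (n : nat) (L : seq (seq nat)) (huniq : uniq L)
  (hL : forall s : seq nat, s \in L <->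
          [/\ is_partition n s,
              (forall i : nat, (1 <= i)%N -> (phi s i + phi s i.+1 < d * k + e)%N),
              (phi s 1 < d * a)%N &
              (forall i : nat, (d %| phi s (2 * i).+1)%N)]) :
  (size L)%:Z =
  (qpoch_tr n (d * a) (2 * d * k + 2 * e + d)
   * qpoch_tr n (2 * d * k - d * a + 2 * e + d) (2 * d * k + 2 * e + d)
   * qpoch_tr n (2 * d * k + 2 * e + d) (2 * d * k + 2 * e + d)
   * qpoch_inv_tr n d (2 * d)
   * qpoch_inv_tr n 2 2)`_n.
Proof.
have /andP[a_gt0 a_k] := ha; have /andP[d_gt0 _] := hd.
have da_K : (0 < d * a <= d * k + e)%N by nia.
have n_m : (n <= 2 * n.+2)%N by lia.
rewrite (size_restricted_partitions n_m da_K huniq hL).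
rewrite -natz -coef_admissible_gf.
rewrite -(coef_in_qpolyXn _ (leqnn n)) -[RHS](coef_in_qpolyXn _ (leqnn n)).
rewrite rmorph_admissible_gf.
rewrite (admissible_gf_product (in_qpolyX_nil _ n) d_gt0 he a_gt0 a_k) !rmorphM /=.
have -> : (2 * (d * k + e) + d = 2 * d * k + 2 * e + d)%N by ring.
by have -> : (2 * d * k + 2 * e + d - d * a = 2 * d * k - d * a + 2 * e + d)%N by nia.
Qed.
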